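(* Let $0<q\le s$ with $1\le s<\infty$. Assume: (i) for all $a\in A$, $c\in C$, $g\in G$ the map $K\to\mathbb{R}$, $\varphi\mapsto\mathbf{H}(a,c,g,\varphi)$, is continuous; (ii) for all $T\in\mathcal{H}$, $a\in A$, $c\in C$, $g\in G$ the map $W\to\mathbb{R}$, $\psi\mapsto\mathbf{M}(T,a,c,g,\psi)$, is continuous; (iii) for every Borel probability measure $\mu$ on $W$ there is an $\mathbf{H}_1$--$\mathbf{Q}_1$-abstract $s$-summing map $\mathbf{J}_\mu\in\mathcal{H}_1$ with $\pi_{\mathbf{H}_1\mathbf{Q}_1,s}(\mathbf{J}_\mu)\le1$ such that $$\left[\int_W|\mathbf{M}(T,a,c,g,\psi)|^s\,d\mu(\psi)\right]^{1/s}\le|\mathbf{Q}_2(\mathbf{J}_\mu\circ T,a,c,g)|$$ for all $T\in\mathcal{H}$, $a\in A$, $c\in C$, $g\in G$. Then a map $T\in\mathcal{H}$ is $\mathbf{H}$--$\mathbf{M}$-$((s;q),q)$-mixing if and only if there exists a constant $\delta\ge0$ such that for every Borel probability measure $\mu$ on $W$ there exists a Borel probability measure $\nu$ on $K$ such that $$\left[\int_W|\mathbf{M}(T,a,c,g,\psi)|^s\,d\mu(\psi)\right]^{1/s}\le\delta\cdot\left[\int_K|\mathbf{H}(a,c,g,\varphi)|^q\,d\nu(\varphi)\right]^{1/q}$$ for all $a\in A$, $c\in C$, $g\in G$. Moreover, $\mathbf{HM}_{((s;q),q)}(T)$ is the infimum of all such $\delta$.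
   Context: $A,B,C,C_1,D$ are non-void sets; $G$ is a Banach space; $K,W$ are (non-void) compact Hausdorff spaces; $\mathcal{H},\mathcal{H}_1,\mathcal{H}_2$ are non-void families of mappings from $A$ into $B$, from $B$ into $D$, and from $A$ into $D$, respectively, with $S\circ T\in\mathcal{H}_2$ for $T\in\mathcal{H}$, $S\in\mathcal{H}_1$. Given are maps $\mathbf{H}:A\times C\times G\times K\to\mathbb{R}$, $\mathbf{H}_1:B\times C_1\times G\times W\to\mathbb{R}$, $\mathbf{Q}_1:\mathcal{H}_1\times B\times C_1\times G\to\mathbb{R}$, $\mathbf{Q}_2:\mathcal{H}_2\times A\times C\times G\to\mathbb{R}$, $\mathbf{M}:\mathcal{H}\times A\times C\times G\times W\to\mathbb{R}$. Abstract summing maps: $S\in\mathcal{H}_1$ is $\mathbf{H}_1$--$\mathbf{Q}_1$-abstract $s$-summing if there is $\delta>0$ with $$\left[\sum_{j=1}^m|\sigma_j|^s|\mathbf{Q}_1(S,b_j,c_j,g_j)|^s\right]^{1/s}\le\delta\sup_{\psi\in W}\left[\sum_{j=1}^m|\sigma_j|^s|\mathbf{H}_1(b_j,c_j,g_j,\psi)|^s\right]^{1/s}$$ for all $m\in\mathbb{N}$, nonzero $\sigma_j\in\mathbb{R}$, $b_j\in B$, $c_j\in C_1$, $g_j\in G$; the infimum of such $\delta$ is $\pi_{\mathbf{H}_1\mathbf{Q}_1,s}(S)$. Mixing maps: let $r\in(0,\infty]$ with $\frac1r+\frac1s=\frac1q$ (for $r=\infty$, $[\sum|\tau_j|^r]^{1/r}$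 means $\max|\tau_j|$). For nonzero reals $\sigma_j$ and $a_j\in A$, $c_j\in C$, $g_j\in G$ set $$\mathfrak{m}^{\mathbf{M}}_{(s;q)}\left((\sigma_j,T,a_j,c_j,g_j,\psi)\right)_{j=1}^m=\inf\left[\sum_{j=1}^m|\tau_j|^r\right]^{1/r}\sup_{\psi\in W}\left[\sum_{j=1}^m\left|\frac{\sigma_j}{\tau_j}\right|^s|\mathbf{M}(T,a_j,c_j,g_j,\psi)|^s\right]^{1/s},$$ the infimum being over all families of nonzero numbers $\tau_1,\dots,\tau_m$. $T\in\mathcal{H}$ is $\mathbf{H}$--$\mathbf{M}$-$((s;q),q)$-mixing if there is $\delta\ge0$ with $$\mathfrak{m}^{\mathbf{M}}_{(s;q)}\left((\sigma_j,T,a_j,c_j,g_j,\psi)\right)_{j=1}^m\le\delta\sup_{\varphi\in K}\left[\sum_{j=1}^m|\sigma_j|^q|\mathbf{H}(a_j,c_j,g_j,\varphi)|^q\right]^{1/q}$$ for all $m\in\mathbb{N}$, nonzero $\sigma_j\in\mathbb{R}$, $a_j\in A$, $c_j\in C$, $g_j\in G$; the infimum of such $\delta$ is $\mathbf{HM}_{((s;q),q)}(T)$. *)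

(* Defs.v *)
(* Written in MathComp-Analysis. *)
From HB Require Import structures.
From mathcomp Require Import all_boot all_order all_algebra.
From mathcomp Require Import all_classical all_reals all_analysis.
Export numFieldNormedType.Exports.

Set Implicit Arguments.
Unset Strict Implicit.
Unset Printing Implicit Defensive.

Import Order.TTheory GRing.Theory Num.Theory.

Local Open Scope classical_set_scope.
Local Open Scope ring_scope.
Local Open Scope ereal_scope.

(* X with its Borel sigma-algebra; [X] must be pointed, i.e. non-void, for
   this to be a [measurableType]. *)
Notation Borel X := (g_sigma_algebraType (@open X)).

Section finite_families.
Context {R : realType}.

(* Only used for r in ]0, +oo]; the value at -oo is junk. *)
Definition lnorm (r : \bar R) (m : nat) (t : 'I_m -> R) : R :=
  (if r is p%:E then (\sum_(j < m) `|t j| `^ p) `^ p^-1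
   else \big[Num.max/0]_(j < m) `|t j|)%R.

Definition wnorm (p : R) (m : nat) (sigma f : 'I_m -> R) : R :=
  ((\sum_(j < m) `|sigma j| `^ p * `|f j| `^ p) `^ p^-1)%R.

(* The supremum over X of wnorm p sigma (f _ x); it is extended-real valued,
   as it may be infinite when nothing is assumed on f. *)
Definition sup_wnorm (X : Type) (p : R) (m : nat) (sigma : 'I_m -> R)
    (f : 'I_m -> X -> R) : \bar R :=
  ereal_sup [set (wnorm p sigma (f ^~ x))%:E | x in [set: X]].

End finite_families.

Section summing.
Context {R : realType} {B C1 D G W : Type}.
Variables (H1 : B -> C1 -> G -> W -> R) (Q1 : (B -> D) -> B -> C1 -> G -> R).
Variable s : R.

Definition summing_const (S : B -> D) (delta : R) : Prop :=
  forall (m : nat) (sigma : 'I_m -> R) (b : 'I_m -> B) (c : 'I_m -> C1)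
    (g : 'I_m -> G), (0 < m)%N -> (forall j, sigma j != 0%R) ->
  (wnorm s sigma (fun j => Q1 S (b j) (c j) (g j)))%:E <=
    delta%:E * sup_wnorm s sigma (fun j psi => H1 (b j) (c j) (g j) psi).

Definition abstract_summing (S : B -> D) : Prop :=
  exists delta : R, (0 < delta)%R /\ summing_const S delta.

Definition summing_norm (S : B -> D) : \bar R :=
  ereal_inf [set delta%:E | delta in
    [set delta : R | (0 < delta)%R /\ summing_const S delta]].

End summing.

Section mixing.
Context {R : realType} {A B C G K W : Type}.
Variables (H : A -> C -> G -> K -> R) (M : (A -> B) -> A -> C -> G -> W -> R).
(* In the (s;q)-quantity below q occurs only through r, where
   1/r + 1/s = 1/q. *)
Variables (s q : R) (r : \bar R).

Definition mixing_quantity (m : nat) (sigma : 'I_m -> R) (T : A -> B)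
    (a : 'I_m -> A) (c : 'I_m -> C) (g : 'I_m -> G) : \bar R :=
  ereal_inf [set (lnorm r tau)%:E *
      sup_wnorm s (fun j => (sigma j / tau j)%R)
        (fun j psi => M T (a j) (c j) (g j) psi)
    | tau in [set tau : 'I_m -> R | forall j, tau j != 0%R]].

Definition mixing_const (T : A -> B) (delta : R) : Prop :=
  forall (m : nat) (sigma : 'I_m -> R) (a : 'I_m -> A) (c : 'I_m -> C)
    (g : 'I_m -> G), (0 < m)%N -> (forall j, sigma j != 0%R) ->
  mixing_quantity sigma T a c g <=
    delta%:E * sup_wnorm q sigma (fun j phi => H (a j) (c j) (g j) phi).

Definition mixing (T : A -> B) : Prop :=
  exists delta : R, (0 <= delta)%R /\ mixing_const T delta.

Definition mixing_norm (T : A -> B) : \bar R :=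
  ereal_inf [set delta%:E | delta in
    [set delta : R | (0 <= delta)%R /\ mixing_const T delta]].

End mixing.

Section domination.
Context {R : realType}.

(* [ \int |f|^p dmu ]^(1/p) for a Borel measure mu on X *)
Definition int_norm (X : ptopologicalType) (mu : probability (Borel X) R)
    (p : R) (f : X -> R) : \bar R :=
  (\int[mu]_(x in [set: Borel X]) (`|f x| `^ p)%:E) `^ p^-1.

Definition domination_const {A B C G : Type} {K W : ptopologicalType}
    (H : A -> C -> G -> K -> R) (M : (A -> B) -> A -> C -> G -> W -> R)
    (s q : R) (T : A -> B) (delta : R) : Prop :=
  forall mu : probability (Borel W) R,
  exists nu : probability (Borel K) R,
  forall (a : A) (c : C) (g : G),
    int_norm mu s (M T a c g) <= delta%:E * int_norm nu q (H a c g).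

End domination.

(* Main.v *)
Require Import Defs.
From HB Require Import structures.
From mathcomp Require Import all_boot all_order all_algebra.
From mathcomp Require Import all_classical all_reals all_analysis.
From mathcomp Require Import measurable_realfun ring lra.

(* The two conditions are equivalent constant by constant.

   From mixing to domination, fix mu. Hoelder's inequality with exponents r/q
   and s/q turns the mixing inequality into
     sum_j w_j N_j <= sup_phi sum_j w_j delta^q |H_j(phi)|^q,
   where N_j = (int |M_j|^s dmu)^(q/s), for all positive weights w_j. By finite
   dimensional separation, finitely many of the inequalities
   N <= int delta^q |H|^q dnu hold up to epsilon for some probability nu; these
   conditions generate a filter on the set of probabilities. Along a finer
   ultrafilter the measures of closed sets converge to a content, from which a
   Borel probability satisfying all the inequalities is built. This replaces
   the Riesz representation theorem, as only an inequality between integrals is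
   needed.

   From domination to mixing, the hypothesis bounds sum_j (int x_j dmu)^(q/s)
   uniformly in mu, where x_j = |sigma_j M_j|^s. The derivative of this concave
   function at a near maximiser gives the numbers tau_j. *)

Set Implicit Arguments.
Unset Strict Implicit.
Unset Printing Implicit Defensive.

Import Order.TTheory GRing.Theory Num.Theory.

Local Open Scope classical_set_scope.
Local Open Scope ring_scope.

(** * Inequalities and convex sets in R^m *)

Section real_inequalities.
Context {R : realType}.
Implicit Types (a b p t : R) (m : nat).

Lemma weighted_young p a b : 0 < p < 1 -> 0 <= a -> 0 <= b ->
  a `^ p * b `^ (1 - p) <= p * a + (1 - p) * b.
Proof.
move=> /andP[p0 p1] a0 b0; have p1' : 0 < 1 - p by rewrite subr_gt0.
have := @conjugate_powR R (a `^ p) (b `^ (1 - p)) p^-1 (1 - p)^-1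
  (powR_ge0 _ _) (powR_ge0 _ _).
rewrite !invr_gt0 !invrK subrKC => /(_ p0 p1' erefl).
rewrite -!powRrM !mulfV ?gt_eqF// !powRr1//.
by rewrite mulrC [X in _ <= _ + X]mulrC mulrC [X in _ <= X + _]mulrC.
Qed.

(** Concavity: dividing the weighted Young inequality by b^(1-p) puts x^p below its tangent at
    [b]. *)
Lemma powR_le_tangent p a b : 0 < p < 1 -> 0 <= a -> 0 < b ->
  a `^ p <= b `^ p + p * b `^ (p - 1) * (a - b).
Proof.
move=> p01 a0 b0; have bp : 0 < b `^ (p - 1) by rewrite powR_gt0.
have := weighted_young p01 a0 (ltW b0).
rewrite -(ler_pM2r bp) -[leLHS]mulrA -powRD; last by rewrite (gt_eqF b0) implybT.
rewrite addrA subrK subrr powRr0 mulr1 => /le_trans; apply.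
have -> : b `^ p = b * b `^ (p - 1).
  by case/andP: p01 => p0 _; rewrite mulr_powRB1// ltW.
lra.
Qed.

Lemma le0_ger_powR p a b : p <= 0 -> 0 < a -> a <= b -> b `^ p <= a `^ p.
Proof.
move=> p0 a0 ab; have b0 := lt_le_trans a0 ab.
rewrite -(opprK p) !(powRN _ (- p)) lef_pV2 ?posrE ?powR_gt0//.
by apply: ge0_ler_powR; rewrite ?nnegrE ?oppr_ge0// ltW.
Qed.

(** Normalise both sums to 1 and add up the weighted Young inequalities. A zero sum cannot be
    normalised, but then every term on the left vanishes. *)
Lemma hoelder_sum m p (a b : 'I_m -> R) : 0 < p < 1 ->
  (forall j, 0 <= a j) -> (forall j, 0 <= b j) ->
  \sum_j a j `^ p * b j `^ (1 - p) <=
  (\sum_j a j) `^ p * (\sum_j b j) `^ (1 - p).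
Proof.
move=> p01 a0 b0; have /andP[p0 p1] := p01.
have p1' : 0 < 1 - p by rewrite subr_gt0.
set Sa := \sum_j a j; set Sb := \sum_j b j.
have [Sa0|Sa0] := eqVneq Sa 0.
  have aE j : a j = 0.
    by move/eqP : Sa0; rewrite psumr_eq0// => /allP/(_ j (mem_index_enum _))/eqP.
  rewrite Sa0 powR0 ?gt_eqF// mul0r big1// => j _.
  by rewrite aE powR0 ?gt_eqF// mul0r.
have [Sb0|Sb0] := eqVneq Sb 0.
  have bE j : b j = 0.
    by move/eqP : Sb0; rewrite psumr_eq0// => /allP/(_ j (mem_index_enum _))/eqP.
  rewrite Sb0 [X in _ * X]powR0 ?gt_eqF// mulr0 big1// => j _.
  by rewrite bE [X in _ * X]powR0 ?gt_eqF// mulr0.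
have Sap : 0 < Sa by rewrite lt_neqAle eq_sym Sa0 sumr_ge0.
have Sbp : 0 < Sb by rewrite lt_neqAle eq_sym Sb0 sumr_ge0.
set k := Sa `^ p * Sb `^ (1 - p).
have k0 : 0 <= k by rewrite mulr_ge0 ?powR_ge0.
have H j : a j `^ p * b j `^ (1 - p) <= k * (p * (a j / Sa) + (1 - p) * (b j / Sb)).
  have {1}-> : a j = Sa * (a j / Sa) by rewrite mulrC divfK.
  have {1}-> : b j = Sb * (b j / Sb) by rewrite [RHS]mulrC divfK.
  have aS : 0 <= a j / Sa by rewrite divr_ge0// ltW.
  have bS : 0 <= b j / Sb by rewrite divr_ge0// ltW.
  rewrite (powRM _ (ltW Sap) aS) (powRM _ (ltW Sbp) bS) mulrACA ler_wpM2l//.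
  exact: weighted_young.
apply: (le_trans (ler_sum _ (fun j _ => H j))).
rewrite -mulr_sumr big_split/= -!mulr_sumr -!mulr_suml !mulfV//.
by rewrite !mulr1 subrKC mulr1.
Qed.

Definition fconvex m (V : set ('I_m -> R)) : Prop :=
  forall u v t, V u -> V v -> 0 <= t <= 1 ->
    V (fun j => (1 - t) * u j + t * v j).

(** The squared positive part has a 2-Lipschitz derivative, whence this quadratic bound; it controls
    the cost of a Frank-Wolfe step. *)
Lemma sqr_maxr0D (x y : R) :
  (Num.max 0 (x + y)) ^+ 2 <=
  (Num.max 0 x) ^+ 2 + 2 * Num.max 0 x * y + y ^+ 2.
Proof.
rewrite /Num.max; case: ifPn => h1; case: ifPn => h2.
- lra.
- by rewrite -leNgt in h2; nra.
- by rewrite -leNgt in h1; nra.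
- by rewrite expr0n/= !(mulr0,mul0r) !add0r sqr_ge0.
Qed.

(* Frank-Wolfe: were [D], the infimum over [V] of the squared positive part of
   [F - v], positive, a small step from a near minimiser [v] towards the point
   that the hypothesis yields for the weights [w = (F - v)^+] would go below
   [D]. *)
Lemma finite_separation m (V : set ('I_m -> R)) (F : 'I_m -> R) (B : R) :
  fconvex V -> V !=set0 -> (forall v, V v -> forall j, `|v j| <= B) ->
  (forall w : 'I_m -> R, (forall j, 0 < w j) -> forall e, 0 < e ->
    exists2 v, V v & \sum_j w j * F j <= \sum_j w j * v j + e) ->
  forall e, 0 < e -> exists2 v, V v & forall j, F j - e <= v j.
Proof.
move=> cV [v0 Vv0] bV hyp0 e e0.
(* Extension to weights that may vanish: they are shifted by [h], so small that the shift costs at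
   most [e / 2]; [C] bounds the sum of the [v j - F j] for [v] in [V]. *)
have hyp (w : 'I_m -> R) : (forall j, 0 <= w j) -> forall e, 0 < e ->
    exists2 v, V v & \sum_j w j * F j <= \sum_j w j * v j + e.
  move=> w0 {}e {}e0; pose C := \sum_j (B + `|F j|).
  have C0 : 0 <= C.
    by apply: sumr_ge0 => j _; rewrite addr_ge0// (le_trans _ (bV _ Vv0 j)).
  pose h := e / 2 / (C + 1).
  have h0 : 0 < h by rewrite !divr_gt0// ltr_wpDl.
  have e20 : 0 < e / 2 by rewrite divr_gt0.
  have [|v Vv H] := hyp0 (fun j => w j + h) _ (e / 2) e20.
    by move=> j; rewrite ltr_wpDl.
  exists v => //; move: H.
  have : \sum_j h * (v j - F j) <= e / 2.
    rewrite -mulr_sumr (@le_trans _ _ (h * C))//.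
      rewrite ler_wpM2l ?(ltW h0)//; apply: ler_sum => j _.
      have /ler_normlP[_ ?] := bV _ Vv j.
      by have := ler_norm (- F j); rewrite normrN; lra.
    rewrite /h -mulrA ler_piMr//; first by rewrite divr_ge0// ltW.
    by rewrite mulrC ler_pdivrMr ?mul1r ?lerDl// ltr_wpDl.
  under eq_bigr do rewrite mulrBr.
  rewrite sumrB.
  under [\sum_j (w j + h) * v j]eq_bigr do rewrite mulrDl.
  under [\sum_j (w j + h) * F j]eq_bigr do rewrite mulrDl.
  rewrite !big_split/=; lra.
pose d (v : 'I_m -> R) := \sum_j (Num.max 0 (F j - v j)) ^+ 2.
have d0 v : 0 <= d v by apply: sumr_ge0 => j _; exact: sqr_ge0.
(* If [d v] is below e^2, so is each of its terms, and [v] is the required point. Otherwise the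
   infimum [D] is at least e^2, which is refuted below. *)
have [[v Vv dv]|nd] := pselect (exists2 v, V v & d v < e ^+ 2).
  exists v => // j; rewrite lerBlDl -lerBlDr leNgt; apply/negP => ej.
  move: dv; rewrite ltNge => /negP; apply.
  rewrite /d (bigD1 j)//= ler_wpDr//.
    by apply: sumr_ge0 => i _; exact: sqr_ge0.
  rewrite ler_sqr ?nnegrE ?(ltW e0)//; last by rewrite le_max lexx.
  by rewrite le_max (ltW ej) orbT.
pose D := inf (d @` V).
have hinf : has_inf (d @` V).
  by split; [exists (d v0), v0|exists 0 => _ [v _ <-]].
have De : e ^+ 2 <= D.
  apply: lb_le_inf; first by exists (d v0), v0.
  by move=> _ [v Vv <-]; rewrite leNgt; apply/negP => dv; apply: nd; exists v.
have D0 : 0 < D by rewrite (lt_le_trans _ De)// exprn_gt0.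
pose C := \sum_(j < m) (2 * B) ^+ 2.
have C0 : 0 <= C by apply: sumr_ge0 => j _; exact: sqr_ge0.
(* This step size gives t^2 (3 + C) < t D. The step from [v] to [v'] gains 2 t D, against errors t^2
   (near minimality of [v]), 2 t^2 (the error [t] in [hyp]) and t^2 C (quadratic remainder), so
   [d v'] would fall below [D]. *)
pose t := D / (3 + C + D).
have CD0 : 0 < 3 + C + D by lra.
have t0 : 0 < t by rewrite divr_gt0.
have t1 : t <= 1 by rewrite /t ler_pdivrMr// mul1r; lra.
have [_ [v Vv <-] dv] := inf_adherent (mulr_gt0 t0 t0) hinf.
pose w j := Num.max 0 (F j - v j).
have w0 j : 0 <= w j by rewrite le_max lexx.
have [z Vz wz] := hyp w w0 t t0.
pose v' j := (1 - t) * v j + t * z j.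
have Vv' : V v' by apply: cV => //; rewrite (ltW t0).
have Dv' : D <= d v' by apply: ge_inf; [exact: hinf.2|exists v'].
have wx : \sum_j w j * (v j - z j) <= - d v + t.
  have : \sum_j w j * (F j - v j) = d v.
    apply: eq_bigr => j _; rewrite /w /Num.max; case: ifPn => _; first by ring.
    by rewrite mul0r expr0n.
  move: wz.
  under [\sum_j w j * (F j - v j)]eq_bigr do rewrite mulrBr.
  under [\sum_j w j * (v j - z j)]eq_bigr do rewrite mulrBr.
  rewrite !sumrB; lra.
have : d v' <= d v + 2 * t * (\sum_j w j * (v j - z j)) + t ^+ 2 * C.
  rewrite /d /C !mulr_sumr -!big_split/=; apply: ler_sum => j _.
  have -> : F j - v' j = (F j - v j) + t * (v j - z j) by rewrite /v'; ring.
  apply: (le_trans (sqr_maxr0D _ _)).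
  have -> : 2 * t * (w j * (v j - z j)) = 2 * w j * (t * (v j - z j)) by ring.
  rewrite lerD2l exprMn ler_wpM2l ?sqr_ge0//.
  have B0 := le_trans (normr_ge0 _) (bV _ Vv0 j).
  have /ler_normlP[? ?] := bV _ Vv j.
  have /ler_normlP[? ?] := bV _ Vz j.
  nra.
have dvD : D <= d v by apply: ge_inf; [exact: hinf.2|exists v].
have tD : t * (3 + C + D) = D by rewrite /t divfK ?gt_eqF.
by nra.
Qed.

(* [v] nearly maximises the concave function [v |-> \sum_j v j `^ p]; the
   conclusion says that its derivative at [v] in the direction [u - v] is
   nearly nonpositive. *)
Lemma near_maximizer m (V : set ('I_m -> R)) (p c B E : R) :
  0 < p < 1 -> 0 < c -> fconvex V -> V !=set0 ->
  (forall v, V v -> forall j, c <= v j <= B) ->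
  (forall v, V v -> \sum_j v j `^ p <= E) ->
  forall e, 0 < e -> exists2 v, V v &
    forall u, V u -> \sum_j v j `^ (p - 1) * u j <= E + e.
Proof.
move=> p01 c0 cV [v0 Vv0] bV EV e e0; have /andP[p0 p1] := p01.
pose f (v : 'I_m -> R) := \sum_j v j `^ p.
have hsup : has_sup (f @` V).
  by split; [exists (f v0), v0|exists E => _ [v Vv <-]; exact: EV].
pose F := sup (f @` V).
have FE : F <= E.
  by apply: ge_sup; [exists (f v0), v0|move=> _ [v Vv <-]; exact: EV].
have E0 : 0 <= E.
  by apply: le_trans (EV _ Vv0); apply: sumr_ge0 => j _; exact: powR_ge0.
(* [b] bounds the ratios [u j / v j] for [u] and [v] in [V]. The errors of the three steps below add
   up to at most t k (1 + b), which dictates [t]. *)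
pose b := `|B| / c.
have b0 : 0 <= b by rewrite divr_ge0// ltW.
pose k := 2 * E + p^-1.
have ip0 : 0 < p^-1 by rewrite invr_gt0.
have k0 : 0 < k by rewrite /k; lra.
have kb0 : 0 < k * (1 + b) by rewrite mulr_gt0//; lra.
pose t := Num.min (2^-1) (e / (k * (1 + b))).
have t0 : 0 < t by rewrite lt_min invr_gt0 ltr0n/= divr_gt0.
have t2 : t <= 2^-1 by rewrite ge_min lexx.
have te : t * (k * (1 + b)) <= e by rewrite -ler_pdivlMr// ge_min lexx orbT.
have [_ [v Vv <-] fv] := sup_adherent (mulr_gt0 t0 t0) hsup.
exists v => // u Vu.
pose y j := (1 - t) * v j + t * u j.
have Vy : V y by apply: cV => //; rewrite (ltW t0)/= (le_trans t2)// invf_le1 ?ler1n.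
have v_gt0 j : 0 < v j by have /andP[] := bV _ Vv j; lra.
have u_gt0 j : 0 < u j by have /andP[] := bV _ Vu j; lra.
have y_gt0 j : 0 < y j by have /andP[] := bV _ Vy j; lra.
(* The tangent is taken at [y], not at [v]: [f v] is within t^2 of the supremum [F] and [f y] is at
   most [F], so concavity bounds the slope at [y] in the direction [u - v]. *)
have step1 : \sum_j y j `^ (p - 1) * (u j - v j) <= t / p.
  rewrite ler_pdivlMr// -(ler_pM2l t0).
  have : f v <= f y - t * ((\sum_j y j `^ (p - 1) * (u j - v j)) * p).
    rewrite /f mulr_suml mulr_sumr -sumrB; apply: ler_sum => j _.
    apply: (le_trans (powR_le_tangent p01 (ltW (v_gt0 j)) (y_gt0 j))).
    by rewrite /y; lra.
  have : f y <= F by apply: ub_le_sup; [exact: hsup.2|exists y].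
  by move: fv; rewrite -/F; lra.
(* By [y j >= (1 - t) * v j], and 1/(1-t) <= 1 + 2t because t <= 1/2. *)
have step2 : \sum_j y j `^ (p - 1) * v j <= (1 + 2 * t) * E.
  apply: (@le_trans _ _ ((1 + 2 * t) * f v)); last by rewrite ler_wpM2l ?EV//; lra.
  rewrite mulr_sumr; apply: ler_sum => j _.
  have -> : v j `^ p = v j `^ (p - 1) * v j by rewrite mulrC mulr_powRB1// ltW.
  rewrite mulrA ler_wpM2r ?(ltW (v_gt0 j))//.
  have yv : (1 - t) * v j <= y j by rewrite /y lerDl mulr_ge0// ltW.
  have t1 : 0 < 1 - t by lra.
  have pn : p - 1 <= 0 by lra.
  have vt : 0 < (1 - t) * v j by rewrite mulr_gt0.
  apply: (le_trans (le0_ger_powR pn vt yv)).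
  rewrite powRM ?(ltW t1)// ?(ltW (v_gt0 j))// ler_wpM2r ?powR_ge0//.
  apply: (@le_trans _ _ ((1 - t) `^ (-1))).
    by apply: ger_powR; [rewrite t1; lra|lra].
  rewrite powR_inv1 ?(ltW t1)// -[leLHS]mul1r ler_pdivrMr//; nra.
(* Back from the slope at [y] to the slope at [v], by [y j <= (1 + t * b) * v j] with [p - 1]
   between -1 and 0. *)
have step3 : \sum_j v j `^ (p - 1) * u j <= (1 + t * b) * \sum_j y j `^ (p - 1) * u j.
  rewrite mulr_sumr; apply: ler_sum => j _.
  rewrite mulrA ler_wpM2r ?(ltW (u_gt0 j))//.
  have k1 : 0 < 1 + t * b by rewrite ltr_pwDl// mulr_ge0// ltW.
  have k1' : 1 <= 1 + t * b by rewrite lerDl mulr_ge0// ltW.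
  have yv : y j <= (1 + t * b) * v j.
    have : u j <= b * v j.
      have /andP[cv _] := bV _ Vv j; have /andP[_ uB] := bV _ Vu j.
      rewrite (le_trans uB)// (le_trans (ler_norm _))// /b -mulrA ler_peMr//.
      by rewrite mulrC ler_pdivlMr// mul1r.
    have := v_gt0 j.
    by rewrite /y; nra.
  have pn : p - 1 <= 0 by lra.
  rewrite -ler_pdivrMl//.
  apply: le_trans (le0_ger_powR pn (y_gt0 j) yv).
  rewrite powRM ?(ltW k1)// ?(ltW (v_gt0 j))// ler_wpM2r ?powR_ge0//.
  by rewrite -powR_inv1 ?(ltW k1)//; apply: ler_powR => //; lra.
apply: (le_trans step3).
have : \sum_j y j `^ (p - 1) * u j <= E + t * k.
  move: step1; under eq_bigr do rewrite mulrBr.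
  rewrite sumrB /k; have : t / p = t * p^-1 by [].
  by lra.
move=> h; apply: (@le_trans _ _ ((1 + t * b) * (E + t * k))).
  by rewrite ler_wpM2l// addr_ge0// mulr_ge0// ltW.
have tk : t * k <= 2^-1 * k by rewrite ler_wpM2r ?(ltW k0).
have kE : k = 2 * E + p^-1 by [].
have Ek : E + t * k <= k by lra.
have tb0 : 0 <= t * b by rewrite mulr_ge0// ltW.
have : t * b * (E + t * k) <= t * b * k by rewrite ler_wpM2l.
lra.
Qed.

End real_inequalities.

(** * Borel probabilities from contents on closed sets *)

Section closed_content.
Context {R : realType} {X : ptopologicalType}.
Hypotheses (cptX : compact [set: X]) (hausX : hausdorff_space X).
Local Open Scope ereal_scope.

(** Normality gives an open [P] that contains the part of [C] outside [U] and lies in a closed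
    subset of [V]; [C] is cut along [P]. This carries subadditivity of a content from closed sets to
    open ones. *)
Lemma closed_split (C U V : set X) : closed C -> open U -> open V ->
  C `<=` U `|` V -> exists D E, [/\ closed D, closed E, D `<=` U, E `<=` V &
    C `<=` D `|` E].
Proof.
move=> cC oU oV CUV; have nX : normal_space X by exact: compact_normal.
have cA : closed (C `&` ~` U) by apply: closedI => //; exact: open_closedC.
have VA : set_nbhs (C `&` ~` U) V.
  by apply/set_nbhsP; exists V; split => // x [] /CUV[Ux /(_ Ux)|].
have [W /set_nbhsP[P [ oP AP PW]] WV] := nX _ cA _ VA.
exists (C `&` ~` P), (closure W); split => //.
- by apply: closedI => //; exact: open_closedC.
- exact: closed_closure.
- by move=> x [Cx Px]; apply: contrapT => Ux; apply/Px/AP.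
- move=> x Cx; have [Px|Px] := pselect (P x); last by left.
  by right; apply/subset_closure/PW.
Qed.

(** A normalised content in the sense of Halmos: in a compact Hausdorff space his compact sets are
    the closed ones. The function is total, but constrained on closed sets only. *)
Record closed_content (la : set X -> R) : Prop := ClosedContent {
  closed_content_ge0 : forall C, closed C -> (0 <= la C)%R ;
  closed_content_le : forall C D, closed C -> closed D -> C `<=` D ->
    (la C <= la D)%R ;
  closed_contentU_le : forall C D, closed C -> closed D ->
    (la (C `|` D) <= la C + la D)%R ;
  closed_contentU : forall C D, closed C -> closed D -> C `&` D = set0 ->
    (la C + la D <= la (C `|` D))%R ;
  closed_contentT : la setT = 1%R }.

Variable la : set X -> R.
Hypothesis cla : closed_content la.

Let la0 : la set0 = 0%R.
Proof.
have c0 : closed (@set0 X) by exact: closed0.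
apply/eqP; rewrite eq_le closed_content_ge0// andbT.
by have := closed_contentU cla c0 c0 (setI0 _); rewrite setU0 gerDl.
Qed.

(** First half of the classical passage from a content to a measure: open sets are approximated from
    inside by closed sets; [outer] below then approximates all sets from outside by open ones. *)
Let inner (O : set X) : \bar R :=
  ereal_sup [set (la C)%:E | C in [set C | closed C /\ C `<=` O]].

Let le_inner (C O : set X) : closed C -> C `<=` O -> (la C)%:E <= inner O.
Proof. by move=> cC CO; apply: ereal_sup_ubound; exists C. Qed.

Let inner_ge0 (O : set X) : 0 <= inner O.
Proof.
have -> : 0 = (la set0)%:E by rewrite la0.
by apply: le_inner => //; exact: closed0.
Qed.

Let inner_le1 (O : set X) : inner O <= 1.
Proof.
apply: ge_ereal_sup => _ [C [cC _] <-]; rewrite lee_fin -(closed_contentT cla).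
by apply: (closed_content_le cla) => //; exact: closedT.
Qed.

Let inner_fin (O : set X) : inner O \is a fin_num.
Proof.
by rewrite ge0_fin_numE// (le_lt_trans (inner_le1 _))// ltry.
Qed.

(** By compactness a closed subset of the union lies in finitely many [O n]; [closed_split] peels
    off the last of them, which allows an induction. *)
Let inner_bigcup (O : (set X)^nat) : (forall n, open (O n)) ->
  inner (\bigcup_n O n) <= \sum_(n <oo) inner (O n).
Proof.
move=> oO; apply: ge_ereal_sup => _ [C [cC CO] <-].
have fin n D : closed D -> D `<=` \bigcup_(i < n) O i ->
    (la D)%:E <= \sum_(0 <= i < n) inner (O i).
  elim: n D => [|n IH] D cD DO.
    rewrite big_nil; have -> : D = set0 by rewrite -subset0 => x /DO[].
    by rewrite la0.
  have [|E [F [cE cF EO FO DEF]]] := @closed_split D (\bigcup_(i < n) O i) (O n) cD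
      (bigcup_open (fun i _ => oO i)) (oO n).
    move=> x /DO[i/=]; rewrite ltnS leq_eqVlt => /predU1P[-> ?|lin Oix].
      by right.
    by left; exists i.
  have := closed_content_le cla cD (closedU cE cF) DEF; rewrite -lee_fin.
  move=> /le_trans; apply; have := closed_contentU_le cla cE cF.
  rewrite -lee_fin => /le_trans; apply; rewrite big_nat_recr//= EFinD.
  by apply: leeD; [exact: IH|exact: le_inner].
have : compact C by apply: subclosed_compact cC cptX _.
rewrite compact_cover => /(_ nat setT O (fun i _ => oO i) CO) [s _ Cs].
pose N := (\max_(i <- finmap.enum_fset s) i).+1.
have CN : C `<=` \bigcup_(i < N) O i.
  move=> x /Cs[i/= si Oix]; exists i => //=.
  by rewrite /N ltnS; apply: leq_bigmax_seq.
apply: (le_trans (fin N C cC CN)).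
by apply: nneseries_lim_ge => i _ _; exact: inner_ge0.
Qed.

Let outer (A : set X) : \bar R :=
  ereal_inf [set inner O | O in [set O | open O /\ A `<=` O]].

Let outer_ge0 (A : set X) : 0 <= outer A.
Proof. by apply: le_ereal_inf_tmp => _ [ O _ <-]; exact: inner_ge0. Qed.

Let outer_le (A O : set X) : open O -> A `<=` O -> outer A <= inner O.
Proof. by move=> oO AO; apply: ereal_inf_lbound; exists O. Qed.

Let outer_fin (A : set X) : outer A \is a fin_num.
Proof.
rewrite ge0_fin_numE// (@le_lt_trans _ _ 1) ?ltry//.
by apply: le_trans (inner_le1 setT); apply: outer_le => //; exact: openT.
Qed.

Let outer0 : outer set0 = 0.
Proof.
apply/eqP; rewrite eq_le outer_ge0 andbT.
have : outer set0 <= inner set0 by apply: outer_le => //; exact: open0.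
move=> /le_trans; apply; apply: ge_ereal_sup => _ [C [_ C0] <-].
by have -> : C = set0 by [rewrite -subset0]; rewrite la0.
Qed.

Let le_outer : {homo outer : A B / A `<=` B >-> A <= B}.
Proof.
move=> A B AB; apply: le_ereal_inf_tmp => _ [P [ oP BP] <-].
by apply: outer_le => //; exact: subset_trans BP.
Qed.

Let outer_sigma_subadditive : sigma_subadditive outer.
Proof.
move=> A; apply/lee_addgt0Pr => e e0.
apply: le_trans (epsilon_trick xpredT (fun n => outer_ge0 (A n)) (ltW e0)).
have [ O PO] : {O : (set X)^nat & forall n, [/\ open (O n), A n `<=` O n &
    inner (O n) <= outer (A n) + (e / (2 ^ n.+1)%:R)%:E]}.
  apply: (@choice _ _ (fun n O => [/\ open O, A n `<=` O &
    inner O <= outer (A n) + (e / (2 ^ n.+1)%:R)%:E])) => n.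
  have en0 : (0 < e / (2 ^ n.+1)%:R)%R by rewrite divr_gt0.
  have [_ [ O [ oO AO] <-] /ltW ?] := lb_ereal_inf_adherent en0 (outer_fin (A n)).
  by exists O.
apply: (@le_trans _ _ (inner (\bigcup_n O n))).
  apply: outer_le; first by apply: bigcup_open => n _; have [] := PO n.
  by apply: subset_bigcup => n _; have [] := PO n.
apply: (le_trans (inner_bigcup _)); first by move=> n; have [] := PO n.
apply: lee_nneseries; first by move=> *; exact: inner_ge0.
by move=> n _; have [] := PO n.
Qed.

HB.instance Definition _ := isOuterMeasure.Build R X outer
  outer0 outer_ge0 le_outer outer_sigma_subadditive.

(** For an open [V] above [A], take a closed [C] in the intersection of [V] and [O], then a closed
    [D] in [V] minus [C], an open set containing [A] minus [O]. Additivity on the disjoint [C] and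
    [D] bounds [la C + la D] by [inner V]; then pass to the suprema over [D] and [C]. *)
Let open_caratheodory (O : set X) : open O -> outer.-caratheodory O.
Proof.
move=> oO; apply: le_caratheodory_measurable => A.
apply: le_ereal_inf_tmp => _ [V [ oV AV] <-].
apply: (@le_trans _ _ (inner (V `&` O) + outer (A `&` ~` O))).
  rewrite leeD2r//; apply: outer_le; first exact: openI.
  exact: setSI.
rewrite -leeBrDr//; apply: ge_ereal_sup => _ [C [cC CVO] <-].
rewrite leeBrDr// addeC -leeBrDr//.
apply: (@le_trans _ _ (inner (V `&` ~` C))).
  apply: outer_le; first by apply: openI => //; exact: closed_openC.
  by move=> x [Ax Ox]; split; [exact: AV|move=> /CVO[]].
apply: ge_ereal_sup => _ [D [cD DVC] <-].
rewrite leeBrDr// addeC -EFinD (@le_trans _ _ (la (C `|` D))%:E)//.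
  rewrite lee_fin; apply: (closed_contentU cla) => //.
  by rewrite -subset0 => x [Cx /DVC[]].
apply: le_inner; first exact: closedU.
by move=> x [/CVO[]|/DVC[]].
Qed.

(** [outer] retyped over [Borel X], so that it can carry a measure instance for the Borel sets. *)
Definition radon_of_content : set (Borel X) -> \bar R := outer.

Let borel_caratheodory (A : set (Borel X)) : measurable A ->
  outer.-caratheodory A.
Proof.
move: A; apply: smallest_sub => [|O oO]; last exact: open_caratheodory.
split; first exact: caratheodory_measurable_set0.
- by move=> A mA; rewrite setTD; exact: caratheodory_measurable_setC.
- exact: caratheodory_measurable_bigcup.
Qed.

Let radon_ge0 (A : set (Borel X)) : 0 <= radon_of_content A.
Proof. exact: outer_ge0. Qed.

Let radon_sigma_additive : semi_sigma_additive radon_of_content.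
Proof.
move=> F mF tF mUF; apply: caratheodory_measure_sigma_additive => //.
  by move=> i; exact: borel_caratheodory.
exact: borel_caratheodory.
Qed.

HB.instance Definition _ := isMeasure.Build _ _ _ radon_of_content
  outer0 radon_ge0 radon_sigma_additive.

(** Every open set containing [C] has inner content at least [la C]. Equality may fail, since [la]
    is not assumed to be outer regular. *)
Lemma radon_of_content_closed (C : set X) : closed C ->
  (la C)%:E <= radon_of_content C.
Proof.
by move=> cC; apply: le_ereal_inf_tmp => _ [ O [_ CO] <-]; exact: le_inner.
Qed.

Let radon_setT : radon_of_content setT = 1.
Proof.
apply/eqP; rewrite eq_le; apply/andP; split.
  by apply: le_trans (inner_le1 setT); apply: outer_le => //; exact: openT.
have -> : 1 = (la setT)%:E by rewrite (closed_contentT cla).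
by apply: radon_of_content_closed; exact: closedT.
Qed.

HB.instance Definition _ := Measure_isProbability.Build _ _ _ radon_of_content
  radon_setT.

Lemma closed_content_le_probability :
  exists mu : probability (Borel X) R, forall C : set X, closed C ->
    (la C)%:E <= mu C.
Proof. by exists radon_of_content; exact: radon_of_content_closed. Qed.

End closed_content.

(** * Integrals of continuous functions *)

Section mixture.
Context d {T : measurableType d} {R : realType}.
Variables (a b : {nonneg R}) (mu nu : probability T R).

(** The equation on the coefficients is an argument so that the probability instance can be attached
    to [mixture ab1]. *)
Definition mixture of (a%:num + b%:num = 1) : set T -> \bar R :=
  measure_add (mscale a mu) (mscale b nu).

Variable ab1 : a%:num + b%:num = 1.

HB.instance Definition _ := Measure.on (mixture ab1).

Let mixtureT : mixture ab1 setT = 1%E.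
Proof.
rewrite /mixture measure_addE.
transitivity (a%:num%:E * mu setT + b%:num%:E * nu setT)%E; first by [].
by rewrite !probability_setT !mule1 -EFinD ab1.
Qed.

HB.instance Definition _ := Measure_isProbability.Build _ _ _ (mixture ab1)
  mixtureT.

End mixture.

Lemma convex_probability d (T : measurableType d) (R : realType) (t : R)
    (mu nu : probability T R) : 0 <= t <= 1 ->
  exists rho : probability T R, forall f : T -> R,
    (forall x, 0 <= f x) -> (forall P : probability T R,
      P.-integrable setT (EFin \o f)) ->
    \int[rho]_x f x = (1 - t) * \int[mu]_x f x + t * \int[nu]_x f x.
Proof.
move=> /andP[t0 t1]; have t1' : 0 <= 1 - t by rewrite subr_ge0.
have ab1 : (NngNum t1')%:num + (NngNum t0)%:num = 1 by rewrite /= subrK.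
exists (mixture mu nu ab1) => f f0 intf.
have mf := measurable_int _ (intf mu).
have f0' x : setT x -> (0 <= (f x)%:E)%E by rewrite lee_fin.
rewrite /Rintegral ge0_integral_measure_add// !ge0_integral_mscale//=.
have fmu := integrable_fin_num measurableT (intf mu).
have fnu := integrable_fin_num measurableT (intf nu).
by rewrite fineD ?fin_numM// !fineM.
Qed.

Section borel_probability.
Context {R : realType} {X : ptopologicalType}.
Hypothesis cptX : compact [set: X].
Implicit Types (h f : X -> R) (nu : probability (Borel X) R).

Lemma open_borel (O : set X) : open O -> measurable (O : set (Borel X)).
Proof. by move=> oO; exact: sub_sigma_algebra. Qed.

Lemma closed_borel (C : set X) : closed C -> measurable (C : set (Borel X)).
Proof.
by move=> cC; have := measurableC (open_borel (closed_openC cC)); rewrite setCK.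
Qed.

Lemma continuous_borel h : continuous h ->
  measurable_fun [set: Borel X] (h : Borel X -> R).
Proof.
move=> /continuousP ch; apply: (measurability _ (RGenOpens.measurableE R)).
move=> _ [_ [a [b ->] <-]]; rewrite setTI; apply: open_borel.
exact/ch/interval_open.
Qed.

Lemma continuous_bounded h : continuous h ->
  exists2 B, 0 <= B & forall x, `|h x| <= B.
Proof.
move=> ch; have : compact (h @` setT).
  by apply: continuous_compact cptX; exact: continuous_subspaceT.
move=> /compact_bounded[M [_ hM]].
exists (Num.max 0 M + 1); first by rewrite addr_ge0// le_max lexx.
by move=> x; apply: hM => //; rewrite ltr_pwDr// le_max lexx orbT.
Qed.

Lemma bounded_integrable nu (h : Borel X -> R) B :
  measurable_fun setT h -> (forall x, `|h x| <= B) ->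
  nu.-integrable setT (EFin \o h).
Proof.
move=> mh hB; apply: measurable_bounded_integrable => //.
  by rewrite [X in (X < _)%E](_ : _ = 1%E) ?ltry//; exact: probability_setT.
exists B; split; first exact: num_real.
by move=> M BM x _ /=; rewrite (le_trans (hB x))// ltW.
Qed.

Lemma continuous_integrable nu h : continuous h ->
  nu.-integrable [set: Borel X] (EFin \o h).
Proof.
move=> ch; have [B _ hB] := continuous_bounded ch.
by apply: (@bounded_integrable _ _ B) => //; exact: continuous_borel.
Qed.

Lemma Rintegral_continuousK nu h : continuous h ->
  (\int[nu]_(x in [set: Borel X]) h x)%:E = (\int[nu]_(x in [set: Borel X]) (h x)%:E)%E.
Proof.
move=> ch; rewrite /Rintegral fineK//.
by apply: integrable_fin_num => //; exact: continuous_integrable.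
Qed.

Lemma Rintegral_prob_cst nu (c : R) : \int[nu]_(x in [set: Borel X]) c = c.
Proof.
rewrite Rintegral_cst// [X in fine X](_ : _ = 1%E) ?mulr1//.
exact: probability_setT.
Qed.

Lemma Rintegral_sum nu m (w : 'I_m -> R) (h : 'I_m -> Borel X -> R) :
  (forall j, nu.-integrable setT (EFin \o h j)) ->
  \int[nu]_x (\sum_j w j * h j x) = \sum_j w j * \int[nu]_x h j x.
Proof.
move=> ih; have iwh j : nu.-integrable setT (fun x => (w j * h j x)%:E).
  rewrite (_ : (fun _ => _) = (fun x => (w j)%:E * (h j x)%:E)%E)//.
  by apply: integrableZl => //; exact: ih.
under [RHS]eq_bigr do rewrite -RintegralZl//.
rewrite /Rintegral; under eq_integral do rewrite -sumEFin.
rewrite integral_sum//.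
rewrite (eq_bigr (fun j => (\int[nu]_x (w j * h j x))%:E)); last first.
  by move=> j _; rewrite /Rintegral fineK//; exact: integrable_fin_num.
by rewrite sumEFin.
Qed.

Lemma Rintegral_dirac (x : X) h : continuous h ->
  \int[\d_(x : Borel X)]_(y in [set: Borel X]) h y = h x.
Proof.
move=> ch; rewrite /Rintegral integral_dirac//; last first.
  by apply/measurable_EFinP; exact: continuous_borel.
by rewrite diracT mul1e.
Qed.

End borel_probability.

(** * Limits of probabilities along an ultrafilter *)

Lemma ultra_fmap (T U : Type) (f : T -> U) (F : set_system T) :
  UltraFilter F -> UltraFilter (f @ F).
Proof.
move=> FU; split; first exact: fmap_proper_filter.
move=> G GP FG; rewrite eqEsubset; split => // A GA.
have [//|FnA] := in_ultra_setVsetC (f @^-1` A) FU.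
exfalso; have /(filterI GA) : G (~` A) by exact: FG.
by rewrite setICr; exact: filter_not_empty.
Qed.

Lemma ultra_bounded_cvg (R : realType) (T : Type) (F : set_system T)
    (f : T -> R) (a b : R) : UltraFilter F ->
  (forall x, a <= f x <= b) -> exists l : R, f @ F --> l.
Proof.
move=> FU fab; have := @segment_compact R a b; rewrite compact_ultra.
move=> /(_ (f @ F) (ultra_fmap f FU)) [|l [_ fl]]; last by exists l.
by apply: (@filterE _ F) => x; rewrite /= in_itv/=; exact: fab.
Qed.

Lemma cvg_le (R : realType) (T : Type) (F : set_system T) {FF : ProperFilter F}
    (f g : T -> R) (a b : R) : f @ F --> a -> g @ F --> b ->
  F [set x | f x <= g x] -> a <= b.
Proof.
move=> fa gb fg; rewrite -subr_ge0; apply: (cvgr_to_ge (cvgB gb fa)).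
by apply: filterS fg => x; rewrite subr_ge0.
Qed.

(** The sum is [e] times the number of multiples of [e], from [e] to [n%:R * e], that do not exceed
    [x]; starting at [k.+1] keeps it below [x]. *)
Lemma staircase (R : realType) (e x : R) n : 0 < e -> 0 <= x < n%:R * e ->
  \sum_(k < n) e * (k.+1%:R * e <= x)%R%:R <= x <=
  \sum_(k < n) e * (k.+1%:R * e <= x)%R%:R + e.
Proof.
move=> e0 /andP[x0 xn].
(* The induction drops [x < n%:R * e]: either all steps are counted, or the sum is already within
   [e] of [x]. *)
have : [/\ \sum_(k < n) e * (k.+1%:R * e <= x)%R%:R <= x,
    \sum_(k < n) e * (k.+1%:R * e <= x)%R%:R <= n%:R * e &
    \sum_(k < n) e * (k.+1%:R * e <= x)%R%:R = n%:R * e \/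
    x < \sum_(k < n) e * (k.+1%:R * e <= x)%R%:R + e].
  elim: n {xn} => [|n [IH1 IH2 IH3]].
    by rewrite big_ord0 mul0r; split => //; left.
  rewrite big_ord_recr/=; set S := \sum_(_ < _) _ in IH1 IH2 IH3 *.
  have nS : n.+1%:R * e = n%:R * e + e by rewrite -natr1 mulrDl mul1r.
  rewrite nS; case: (leP (n%:R * e + e) x) => h; rewrite ?mulr1 ?mulr0 ?addr0.
    case: IH3 => h3; last by exfalso; lra.
    by rewrite h3; split => //; left.
  split => //; first by lra.
  by right; case: IH3 => h3; lra.
move=> [-> _ [h|/ltW->//]]/=; rewrite h ltW//.
by rewrite (lt_le_trans xn)// lerDl ltW.
Qed.

Section ultralimit.
Context {R : realType} {X : ptopologicalType}.
Hypotheses (cptX : compact [set: X]) (hausX : hausdorff_space X).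
Implicit Types (h : X -> R) (nu : probability (Borel X) R).

(** A layer-cake approximation of the integral of [h]. It depends on [nu] only through its values on
    finitely many closed sets, hence passes to the limit along an ultrafilter. *)
Let stair h (e : R) (n : nat) nu : R :=
  \sum_(k < n) e * fine (nu [set x | k.+1%:R * e <= h x]).

Let closed_stair h (a : R) : continuous h -> closed [set x | a <= h x].
Proof.
move=> /continuous_closedP ch.
rewrite (_ : mkset _ = h @^-1` [set y | a <= y])//; apply: ch.
exact: closed_ge.
Qed.

Let stair_bounds nu h (e : R) n : continuous h -> 0 < e ->
  (forall x, 0 <= h x < n%:R * e) ->
  stair h e n nu <= \int[nu]_(x in [set: Borel X]) h x <= stair h e n nu + e.
Proof.
move=> ch e0 hn; pose C (k : 'I_n) : set (Borel X) := [set x | k.+1%:R * e <= h x].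
have mC k : measurable (C k) by apply: closed_borel; exact: closed_stair.
have iC k : nu.-integrable setT (EFin \o \1_(C k)).
  apply: (@bounded_integrable _ _ _ _ 1) => //.
  by move=> x; rewrite indicE normr_nat; case: (_ \in _).
pose g x := \sum_(k < n) e * \1_(C k) x.
have ig : nu.-integrable setT (EFin \o g).
  rewrite (_ : _ \o _ = (fun x => \sum_(k < n) (e * \1_(C k) x)%:E)%E); last first.
    by apply/funext => x /=; rewrite sumEFin.
  apply: integrable_sum => // k _.
  rewrite (_ : (fun _ => _) = (fun x => e%:E * (\1_(C k) x)%:E)%E)//.
  by apply: integrableZl => //; exact: iC.
have gE : \int[nu]_(x in [set: Borel X]) g x = stair h e n nu.
  rewrite Rintegral_sum//; apply: eq_bigr => k _; congr (_ * _).
  by rewrite /Rintegral integral_indic// setIT.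
have gh x : g x <= h x <= g x + e.
  have := staircase e0 (hn x); rewrite /g.
  by under [in X in _ -> X]eq_bigr do rewrite indicE mem_setE.
have ih := continuous_integrable cptX nu ch.
rewrite -gE; apply/andP; split.
  by apply: le_Rintegral => // x _; case/andP: (gh x).
have ie : nu.-integrable [set: Borel X] (EFin \o cst e).
  exact: (@bounded_integrable _ _ _ _ `|e|).
rewrite -[X in _ <= _ + X](Rintegral_prob_cst nu) -RintegralD//.
apply: le_Rintegral => //; last by move=> x _; case/andP: (gh x).
rewrite (_ : _ \o _ = (fun x => (g x)%:E + e%:E)%E)//.
exact: integrableD.
Qed.

(* The set function [la C = lim_U nu C] on closed sets determines a Borel
   probability [mu] with [la C <= mu C]; comparing the staircase sums of
   [h] for [nu] and [mu] gives the inequality on integrals. *)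
Lemma ultralimit_probability (U : set_system (probability (Borel X) R)) :
  UltraFilter U -> exists mu : probability (Borel X) R,
  forall h (c : R), continuous h -> (forall x, 0 <= h x) ->
    U [set nu | c <= \int[nu]_(x in [set: Borel X]) h x] ->
    c <= \int[mu]_(x in [set: Borel X]) h x.
Proof.
move=> UU.
have P01 nu (C : set X) : closed C -> 0 <= fine (nu C) <= 1.
  move=> cC; have mC := closed_borel cC; rewrite fine_ge0//=.
  rewrite -lee_fin fineK ?probability_le1//.
  by rewrite ge0_fin_numE// (le_lt_trans (probability_le1 _ mC))// ltry.
have [la laU] : {la : set X -> R & forall C, closed C ->
    (fun nu : probability (Borel X) R => fine (nu C)) @ U --> la C}.
  apply: (@choice _ _ (fun (C : set X) l => closed C ->
    (fun nu : probability (Borel X) R => fine (nu C)) @ U --> l)) => C.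
  have [cC|] := pselect (closed C); last by exists 0.
  have [l ul] := ultra_bounded_cvg UU (fun nu => P01 nu C cC).
  by exists l.
have finC nu (C : set X) : closed C -> nu C \is a fin_num.
  move=> cC; have mC := closed_borel cC.
  by rewrite ge0_fin_numE// (le_lt_trans (probability_le1 _ mC))// ltry.
have cla : closed_content la.
  split.
  - move=> C cC; apply: (cvgr_to_ge (laU _ cC)).
    by apply: filterE => nu; case/andP : (P01 nu C cC).
  - move=> C D cC cD CD; apply: (cvg_le (laU _ cC) (laU _ cD)).
    apply: filterE => nu /=; rewrite fine_le ?finC// le_measure ?inE//.
    + exact: closed_borel.
    + exact: closed_borel.
  - move=> C D cC cD; have cCD := closedU cC cD.
    apply: (cvg_le (laU _ cCD) (cvgD (laU _ cC) (laU _ cD))).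
    apply: filterE => nu; rewrite /= fctE -fineD ?finC// fine_le ?fin_numD ?finC//.
    by apply: measureU2; exact: closed_borel.
  - move=> C D cC cD CD; have cCD := closedU cC cD.
    apply: (cvg_le (cvgD (laU _ cC) (laU _ cD)) (laU _ cCD)).
    apply: filterE => nu; rewrite /= fctE -fineD ?finC// fine_le ?fin_numD ?finC//.
    by rewrite measureU//; exact: closed_borel.
  - have nuT nu : fine (nu [set: X]) = 1 by rewrite (@probability_setT _ (Borel X)).
    apply/eqP; rewrite eq_le; apply/andP; split.
      by apply: (cvgr_to_le (laU _ closedT)); apply: filterE => nu; rewrite nuT.
    by apply: (cvgr_to_ge (laU _ closedT)); apply: filterE => nu; rewrite nuT.
have [mu lamu] := closed_content_le_probability cptX hausX cla.
exists mu => h c ch h0 Uc; apply/ler_addgt0Pr => e e0.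
have [B B0 hB] := continuous_bounded cptX ch.
pose n := (Num.truncn (B / e)).+1.
have hn x : 0 <= h x < n%:R * e.
  rewrite h0/= (le_lt_trans (ler_norm _))// (le_lt_trans (hB x))//.
  by rewrite -ltr_pdivrMr// truncnS_gt.
have /andP[smu _] := stair_bounds mu ch e0 hn.
apply: (@le_trans _ _ (\sum_(k < n) e * la [set x | k.+1%:R * e <= h x] + e)).
  have cs : stair h e n nu @[nu --> U] -->
      \sum_(k < n) e * la [set x | k.+1%:R * e <= h x].
    apply: cvg_big => [|k _]; first exact: add_continuous.
    by apply: cvgMr; apply: laU; exact: closed_stair.
  apply: (cvgr_to_ge (cvgD cs (cvg_cst e))); apply: filterS Uc => nu /= cnu.
  by rewrite (le_trans cnu)//; case/andP: (stair_bounds nu ch e0 hn).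
rewrite lerD2r (le_trans _ smu)//; apply: ler_sum => k _.
rewrite ler_wpM2l ?(ltW e0)// -lee_fin fineK; last exact/finC/closed_stair.
by apply: lamu; exact: closed_stair.
Qed.

End ultralimit.

(** * Domination *)

Section domination.
Context {R : realType} {X : ptopologicalType}.
Hypotheses (cptX : compact [set: X]) (hausX : hausdorff_space X).
Implicit Types (nu : probability (Borel X) R).

(** The convex bounded set of R^m to which [finite_separation] is applied over [K], and
    [near_maximizer] over [W]. *)
Definition integral_vectors m (h : 'I_m -> X -> R) : set ('I_m -> R) :=
  [set v | exists nu, v = (fun j => \int[nu]_(x in [set: Borel X]) h j x)].

Lemma integral_vectors_convex m (h : 'I_m -> X -> R) :
  (forall j, continuous (h j)) -> (forall j x, 0 <= h j x) ->
  fconvex (integral_vectors h).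
Proof.
move=> ch h0 _ _ t [mu ->] [nu ->] t01.
have [rho rhoE] := convex_probability mu nu t01.
exists rho; apply/funext => j; rewrite rhoE// => P.
exact: continuous_integrable.
Qed.

Lemma integral_vectors_dirac m (h : 'I_m -> X -> R) (x : X) :
  (forall j, continuous (h j)) -> integral_vectors h (h ^~ x).
Proof.
by move=> ch; exists \d_(x : Borel X); apply/funext => j; rewrite Rintegral_dirac.
Qed.

Lemma integral_vectors_bounded m (h : 'I_m -> X -> R) :
  (forall j, continuous (h j)) ->
  exists B, forall v, integral_vectors h v -> forall j, `|v j| <= B.
Proof.
move=> ch; have /choice[B hB] : forall j, exists B, 0 <= B /\ forall x, `|h j x| <= B.
  by move=> j; have [B] := continuous_bounded cptX (ch j); exists B.
exists (\sum_j B j) => _ [nu ->] j; rewrite (@le_trans _ _ (B j))//; last first.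
  by rewrite (bigD1 j)//= lerDl sumr_ge0// => i _; case: (hB i).
have ih := continuous_integrable cptX nu (ch j).
apply: le_trans (le_normr_Rintegral measurableT ih) _.
rewrite -[leRHS](Rintegral_prob_cst nu); apply: le_Rintegral => //.
- exact: integrable_norm.
- by apply: (@bounded_integrable _ _ _ _ `|B j|).
- by move=> x _; case: (hB j).
Qed.

Lemma pietsch_domination (I : Type) (N : I -> R) (h : I -> X -> R) :
  (forall i, continuous (h i)) -> (forall i x, 0 <= h i x) ->
  (forall m (i : 'I_m -> I) (w : 'I_m -> R), (0 < m)%N ->
    (forall j, 0 < w j) ->
    exists x, \sum_j w j * N (i j) <= \sum_j w j * h (i j) x) ->
  exists nu, forall i, N i <= \int[nu]_(x in [set: Borel X]) h i x.
Proof.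
move=> ch h0 hyp.
pose idx := {m & 'I_m -> I}.
pose fam m (i : 'I_m -> I) : idx := existT (fun m => 'I_m -> I) m i.
pose S (k : idx * R) : set (probability (Borel X) R) :=
  [set nu | forall j, N (projT2 k.1 j) - k.2 <=
    \int[nu]_(x in [set: Borel X]) h (projT2 k.1 j) x].
(* The basic sets carry a tolerance because [finite_separation] yields approximate solutions only;
   it is removed at the very end. *)
pose F := filter_from [set k : idx * R | 0 < k.2] S.
have FF : Filter F.
  apply: filter_from_filter.
    by exists (fam 0%N (fun i : 'I_0 => False_rect I (notF (ltn_ord i))), 1) => /=.
  move=> [[m i] e] [[n j] d] /= e0 d0.
  (* Concatenating the two families, with the smaller tolerance, refines both basic sets. *)
  exists (fam (m + n)%N
    (fun k => match fintype.split k with inl a => i a | inr b => j b end),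
    Num.min e d) => /=.
    by rewrite lt_min e0.
  move=> nu /= H; split => k /=.
    have := H (lshift n k).
    rewrite /= (unsplitK (inl k) : fintype.split (lshift n k) = inl k) => H1.
    by rewrite (le_trans _ H1)// lerD2l lerN2 ge_min lexx.
  have := H (rshift m k).
  rewrite /= (unsplitK (inr k) : fintype.split (rshift m k) = inr k) => H1.
  by rewrite (le_trans _ H1)// lerD2l lerN2 ge_min lexx orbT.
have PF : ProperFilter F.
  apply: filter_from_proper => -[[m i] e] /= e0.
  have chi j : continuous (h (i j)) by exact: ch.
  have [B vB] := integral_vectors_bounded chi.
  (* Basic sets are nonempty by separation: for given weights the point supplied by [hyp] enters
     through its Dirac measure. *)
  have [||w w0 d d0|_ [nu ->] Hnu] := @finite_separation R m
    (integral_vectors (fun j => h (i j))) (fun j => N (i j)) B _ _ vB _ e e0.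
  - exact: integral_vectors_convex.
  - by exists ((fun j => h (i j)) ^~ point); exact: integral_vectors_dirac.
  (* [hyp] speaks of nonempty families; for the empty one both sums are 0. *)
  - have [m0|m0] := posnP m.
      subst m; exists ((fun j => h (i j)) ^~ point).
        exact: integral_vectors_dirac.
      by rewrite !big_ord0 add0r ltW.
    have [x Hx] := hyp m i w m0 w0.
    exists ((fun j => h (i j)) ^~ x); first exact: integral_vectors_dirac.
    by rewrite (le_trans Hx)// lerDl ltW.
  - by exists nu.
have [U [UU FU]] := ultraFilterLemma PF.
have [mu muU] := ultralimit_probability cptX hausX UU.
exists mu => i; apply/ler_addgt0Pr => e e0; rewrite -lerBlDr.
apply: muU => //; apply: FU.
by exists (fam 1%N (fun=> i), e) => //= nu /(_ ord0).
Qed.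

End domination.

(** * Real powers and weighted norms *)

Lemma powRK (R : realType) (p x : R) : 0 < p -> 0 <= x -> (x `^ p) `^ p^-1 = x.
Proof. by move=> p0 x0; rewrite -powRrM mulfV ?gt_eqF// powRr1. Qed.

Lemma powRVK (R : realType) (p x : R) : 0 < p -> 0 <= x -> (x `^ p^-1) `^ p = x.
Proof. by move=> p0 x0; rewrite -powRrM mulVf ?gt_eqF// powRr1. Qed.

Lemma powR_le (R : realType) (p x y : R) : 0 <= p -> 0 <= x -> x <= y ->
  x `^ p <= y `^ p.
Proof.
move=> p0 x0 xy; have y0 := le_trans x0 xy.
by apply: ge0_ler_powR; rewrite ?nnegrE.
Qed.

(** Write (x+y)^p as x (x+y)^(p-1) + y (x+y)^(p-1) and use that the exponent [p - 1] is
    nonpositive. *)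
Lemma powR_subadditive (R : realType) (p x y : R) : 0 < p <= 1 -> 0 < x ->
  0 < y -> (x + y) `^ p <= x `^ p + y `^ p.
Proof.
move=> /andP[p0 p1] x0 y0; have xy0 : 0 < x + y by rewrite addr_gt0.
have pn : p - 1 <= 0 by rewrite subr_le0.
rewrite -(mulr_powRB1 (ltW xy0) p0) -(mulr_powRB1 (ltW x0) p0).
rewrite -(mulr_powRB1 (ltW y0) p0) mulrDl lerD//.
  by rewrite ler_wpM2l ?(ltW x0)// le0_ger_powR// lerDl ltW.
by rewrite ler_wpM2l ?(ltW y0)// le0_ger_powR// lerDr ltW.
Qed.

Lemma continuous_norm_powR (R : realType) (X : topologicalType) (p : R)
    (f : X -> R) :
  0 < p -> continuous f -> continuous (fun x => `|f x| `^ p).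
Proof.
move=> p0 cf x; apply: (@continuous_comp _ _ _ f (fun t => `|t| `^ p)).
  exact: cf.
(* The power may fail to be differentiable at 0, so zeros of [f] get a direct epsilon argument;
   elsewhere differentiability gives continuity. *)
have [->|fx0] := eqVneq (f x) 0.
  apply/(@cvgrPdist_lt _ R^o) => e e0.
  near=> t; rewrite normr0 powR0 ?gt_eqF// sub0r normrN ger0_norm ?powR_ge0//.
  rewrite -[ltRHS](powRVK p0 (ltW e0)) gt0_ltr_powR ?nnegrE ?powR_ge0//.
  near: t; apply: (@nbhs0_lt _ R^o); exact: powR_gt0.
apply: (@continuous_comp R R R (fun t : R => `|t|) (fun t : R => t `^ p) (f x)).
  exact: norm_continuous.
apply: (@differentiable_continuous _ R^o R^o); apply/derivable1_diffP.
by apply: derivable_powR; rewrite in_itv/= andbT normr_gt0.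
Unshelve. all: by end_near. Qed.

Section wnorm.
Context {R : realType} {X : ptopologicalType}.
Hypothesis cptX : compact [set: X].

Lemma wnormK (p : R) m (sigma f : 'I_m -> R) : 0 < p ->
  wnorm p sigma f `^ p = \sum_j `|sigma j| `^ p * `|f j| `^ p.
Proof.
by move=> p0; rewrite /wnorm powRVK// sumr_ge0.
Qed.

(** The extreme value theorem turns the extended-real supremum into a real number, the value at a
    maximiser. *)
Lemma sup_wnorm_attained (p : R) m (sigma : 'I_m -> R) (f : 'I_m -> X -> R) :
  0 < p -> (forall j, continuous (f j)) ->
  exists2 x0, (sup_wnorm p sigma f = (wnorm p sigma (f ^~ x0))%:E)%E &
    forall x, wnorm p sigma (f ^~ x) <= wnorm p sigma (f ^~ x0).
Proof.
move=> p0 cf; pose F x := \sum_j `|sigma j| `^ p * `|f j x| `^ p.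
have cF : continuous F.
  move=> x; apply: cvg_big => [|j _]; first exact: add_continuous.
  by apply: cvgMr; exact: continuous_norm_powR.
have [||x0 _ maxF] := @compact_EVT_max X R F [set: X] _ cptX.
- by exists point.
- exact: continuous_subspaceT.
have maxw x : wnorm p sigma (f ^~ x) <= wnorm p sigma (f ^~ x0).
  rewrite /wnorm; apply: powR_le; first by rewrite invr_ge0 ltW.
    by apply: sumr_ge0 => j _; rewrite mulr_ge0// powR_ge0.
  by apply: maxF; rewrite inE.
exists x0 => //; apply/eqP; rewrite eq_le; apply/andP; split.
  by apply: ge_ereal_sup => _ [x _ <-]; rewrite lee_fin.
by apply: ereal_sup_ubound; exists x0.
Qed.

Lemma int_normE (mu : probability (Borel X) R) (p : R) (f : X -> R) :
  0 < p -> continuous f ->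
  int_norm mu p f = ((\int[mu]_(x in [set: Borel X]) (`|f x| `^ p)) `^ p^-1)%:E.
Proof.
move=> p0 cf; rewrite /int_norm -poweR_EFin Rintegral_continuousK//.
exact: continuous_norm_powR.
Qed.

Lemma Rintegral_wsum (mu : probability (Borel X) R) m (w : 'I_m -> R)
    (h : 'I_m -> X -> R) : (forall j, continuous (h j)) ->
  \int[mu]_(x in [set: Borel X]) (\sum_j w j * h j x) =
  \sum_j w j * \int[mu]_(x in [set: Borel X]) h j x.
Proof. by move=> ch; apply: Rintegral_sum => j; exact: continuous_integrable. Qed.

Lemma Rintegral_wsum_le (mu : probability (Borel X) R) m (w : 'I_m -> R)
    (h : 'I_m -> X -> R) (b : R) : (forall j, continuous (h j)) ->
  (forall x, \sum_j w j * h j x <= b) ->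
  \sum_j w j * \int[mu]_(x in [set: Borel X]) h j x <= b.
Proof.
move=> ch hb; rewrite -Rintegral_wsum// -[leRHS](Rintegral_prob_cst mu).
apply: le_Rintegral => //.
- apply: continuous_integrable => // x.
  by apply: cvg_big => [|j _]; [exact: add_continuous|apply: cvgMr; exact: ch].
- by apply: (@bounded_integrable _ _ _ _ `|b|).
Qed.

End wnorm.

(** * Mixing *)

Section conjugate_exponents.
Context {R : realType}.
Variables (q s : R) (r : \bar R).
Hypotheses (q0 : 0 < q) (qs : q <= s) (r0 : (0 < r)%E).
Hypothesis rsq : (r^-1 + (s^-1)%:E = (q^-1)%:E)%E.

Let s0 : 0 < s. Proof. exact: lt_le_trans qs. Qed.

Lemma conjugate_exponents_cases : (r = +oo%E /\ q = s) \/
  exists p : R, [/\ r = p%:E, 0 < p, p^-1 + s^-1 = q^-1 & q < s].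
Proof.
case: r r0 rsq => [p| |]//=.
  rewrite lte_fin => p0; rewrite inver gt_eqF// -EFinD => -[pq].
  right; exists p; split => //; rewrite -ltf_pV2 ?posrE// -pq ltrDr.
  by rewrite invr_gt0.
by move=> _; rewrite invey add0e => -[/invr_inj ->]; left.
Qed.

(** For finite r = p, Hoelder with q/p + q/s = 1, applied to |tau_j|^p and y_j. For infinite r, q =
    s and the maximum factors out. *)
Lemma lnorm_hoelder m (tau y : 'I_m -> R) : (forall j, 0 <= y j) ->
  \sum_j `|tau j| `^ q * y j `^ (q / s) <=
  lnorm r tau `^ q * (\sum_j y j) `^ (q / s).
Proof.
move=> y0; case: conjugate_exponents_cases => [[-> ->]|[p [-> p0 pq qs']]].
  rewrite divff ?gt_eqF// powRr1 ?sumr_ge0// mulr_sumr; apply: ler_sum => j _.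
  rewrite powRr1// ler_wpM2r// powR_le//; first exact: ltW.
  exact: le_bigmax.
have t01 : 0 < q / s < 1 by rewrite divr_gt0//= ltr_pdivrMr// mul1r.
have pE : 1 - q / s = q / p.
  have -> : p^-1 = q^-1 - s^-1 by rewrite -pq addrK.
  by rewrite mulrBr divff ?gt_eqF.
have := hoelder_sum t01 y0 (fun j => powR_ge0 (`|tau j|) p).
rewrite pE /lnorm -powRrM [p^-1 * q]mulrC [X in _ <= X -> _]mulrC.
apply: le_trans.
rewrite le_eqVlt; apply/orP; left; apply/eqP/eq_bigr => j _.
by rewrite -powRrM mulrCA divff ?gt_eqF// mulr1 mulrC.
Qed.

Lemma lnorm_cst1_le m : r = +oo%E -> lnorm r (fun _ : 'I_m => 1) <= 1.
Proof.
by move=> ->; rewrite /lnorm; apply: bigmax_le => // j _; rewrite normr1.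
Qed.

Section mixing_weights.
Context {X : ptopologicalType}.
Hypothesis cptX : compact [set: X].

(* For [q < s] the weights are [tau_j = v_j `^ ((1 - q / s) / s)], where [v]
   nearly maximises [\sum_j v_j `^ (q / s)] over the vectors of integrals of
   the [x j + eta]; the shift [eta > 0] keeps them away from [0]. *)
Lemma mixing_weights m (x : 'I_m -> X -> R) (z0 z : R) :
  (forall j, continuous (x j)) -> (forall j t, 0 <= x j t) ->
  0 <= z0 < z ->
  (forall mu : probability (Borel X) R,
    \sum_j (\int[mu]_(t in [set: Borel X]) x j t) `^ (q / s) <= z0 `^ q) ->
  exists tau : 'I_m -> R, [/\ forall j, 0 < tau j, 0 <= lnorm r tau &
    forall t, lnorm r tau * (\sum_j tau j `^ (- s) * x j t) `^ s^-1 <= z].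
Proof.
move=> cx x0 /andP[z00 z0z] hz; have z_gt0 : 0 < z by exact: le_lt_trans z0z.
case: conjugate_exponents_cases => [[rE qsE]|[p [rE p0 pq qs']]].
  (* For infinite r, q = s and constant weights 1 suffice: the hypothesis at the Dirac measure at
     [t] is the required pointwise bound. *)
  exists (fun=> 1); split=> // [|t].
    by rewrite rE /lnorm; apply: bigmax_ge_id.
  rewrite -[leRHS]mul1r; apply: ler_pM; rewrite ?powR_ge0//.
  - by rewrite rE /lnorm; apply: bigmax_ge_id.
  - exact: lnorm_cst1_le.
  rewrite -(powRK s0 (ltW z_gt0)) powR_le ?invr_ge0 ?(ltW s0)//.
    by apply: sumr_ge0 => j _; rewrite mulr_ge0 ?powR_ge0.
  have := hz \d_(t : Borel X); rewrite qsE divff ?gt_eqF// => h.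
  apply: (@le_trans _ _ (z0 `^ s)); last first.
    by rewrite powR_le ?(ltW s0)// ltW.
  apply: le_trans h; apply: ler_sum => j _.
  rewrite (@powR1 R) mul1r Rintegral_dirac// powRr1//.
have t01 : 0 < q / s < 1 by rewrite divr_gt0//= ltr_pdivrMr// mul1r.
have t1 : 0 < q / s <= 1 by case/andP : t01 => -> /ltW.
have e0 : 0 < z `^ q - z0 `^ q by rewrite subr_gt0 gt0_ltr_powR ?nnegrE ?(ltW z_gt0).
set e := z `^ q - z0 `^ q in e0.
have m0 : 0 < m.+1%:R * 2 :> R by rewrite mulr_gt0.
(* Chosen so that the shift adds at most [e / 2] to the sum of powers; [m.+1] avoids a zero
   denominator when m = 0. *)
pose eta : R := (e / (m.+1%:R * 2)) `^ (q / s)^-1.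
have eta0 : 0 < eta by rewrite powR_gt0// divr_gt0.
have etaE : m%:R * eta `^ (q / s) <= e / 2.
  have /andP[? _] := t01; rewrite /eta powRVK//; last by rewrite ltW// divr_gt0.
  rewrite [leLHS](_ : _ = m%:R / m.+1%:R * (e / 2)); last by rewrite invfM; ring.
  by rewrite ler_piMl ?divr_ge0 ?(ltW e0)// ler_pdivrMr// mul1r ler_nat.
pose x' j t := x j t + eta.
have cx' j : continuous (x' j).
  by move=> t; apply: cvgD; [exact: cx|exact: cvg_cst].
have x'0 j t : 0 <= x' j t by rewrite addr_ge0// ltW.
have x'E (mu : probability (Borel X) R) j : \int[mu]_(t in [set: Borel X]) x' j t =
    \int[mu]_(t in [set: Borel X]) x j t + eta.
  rewrite -[in RHS](Rintegral_prob_cst mu eta) -RintegralD//.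
    exact: continuous_integrable.
  by apply: (@bounded_integrable _ _ _ _ `|eta|).
have ix0 (mu : probability (Borel X) R) j : 0 <= \int[mu]_(t in [set: Borel X]) x j t.
  exact: Rintegral_ge0.
have [B VB] := integral_vectors_bounded cptX cx'.
have V_bounds v : integral_vectors x' v -> forall j, eta <= v j <= B.
  move=> Vv j; rewrite (le_trans (ler_norm _) (VB _ Vv j)) andbT.
  by case: Vv => mu ->; rewrite x'E lerDr.
have V_sum v : integral_vectors x' v ->
    \sum_j v j `^ (q / s) <= z0 `^ q + e / 2.
  move=> [mu ->]; apply: le_trans (lerD (hz mu) etaE).
  have -> : m%:R * eta `^ (q / s) = \sum_(j < m) eta `^ (q / s).
    by rewrite sumr_const card_ord -[RHS]mulr_natl.
  rewrite -big_split/=; apply: ler_sum => j _; rewrite x'E.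
  have := ix0 mu j; rewrite le_eqVlt => /predU1P[<-|xj0].
    by rewrite add0r lerDr powR_ge0.
  exact: powR_subadditive.
have V_neq0 : integral_vectors x' !=set0.
  by exists (x' ^~ point); exact: integral_vectors_dirac.
have e20 : 0 < e / 2 by rewrite divr_gt0.
(* One half of the gap [e] pays for the shift by [eta], the other for the near maximality of [v];
   together they give z^q. *)
have [v Vv Hv] := near_maximizer t01 eta0 (integral_vectors_convex cptX cx' x'0)
  V_neq0 V_bounds V_sum e20.
have eE : z0 `^ q + e / 2 + e / 2 = z `^ q by rewrite /e; lra.
rewrite eE in Hv.
have v0 j : 0 < v j by have /andP[+ _] := V_bounds _ Vv j; exact: lt_le_trans.
have sumv : \sum_j v j `^ (q / s) <= z `^ q.
  by apply: (le_trans (V_sum _ Vv)); lra.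
have pE : 1 - q / s = q / p.
  have -> : p^-1 = q^-1 - s^-1 by rewrite -pq addrK.
  by rewrite mulrBr divff ?gt_eqF.
have lE : lnorm r (fun j => v j `^ ((1 - q / s) / s)) = (\sum_j v j `^ (q / s)) `^ p^-1.
  rewrite rE /lnorm; congr (_ `^ _); apply: eq_bigr => j _.
  rewrite ger0_norm ?powR_ge0// -powRrM pE; congr (_ `^ _).
  by field; rewrite !gt_eqF.
exists (fun j => v j `^ ((1 - q / s) / s)); split.
- by move=> j; exact: powR_gt0.
- by rewrite lE powR_ge0.
move=> t; rewrite lE.
(* Since 1/p + 1/s = 1/q, [z] splits into two factors: the first bounds [lnorm r tau] through
   [sumv], the second the weighted sum through [Hv] at the Dirac measure at [t], as tau_j^(-s) =
   v_j^(q/s-1). *)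
have -> : z = (z `^ q) `^ p^-1 * (z `^ q) `^ s^-1.
  rewrite -powRD; last by rewrite pq gt_eqF ?invr_gt0.
  by rewrite pq powRK// ltW.
apply: ler_pM; rewrite ?powR_ge0//.
  by rewrite powR_le ?invr_ge0 ?(ltW p0)//; apply: sumr_ge0 => j _; exact: powR_ge0.
rewrite powR_le ?invr_ge0 ?(ltW s0)//.
  by apply: sumr_ge0 => j _; rewrite mulr_ge0 ?powR_ge0.
apply: le_trans (Hv _ (integral_vectors_dirac t cx')).
apply: ler_sum => j _; rewrite -powRrM.
have -> : (1 - q / s) / s * - s = q / s - 1 by field; rewrite gt_eqF.
by rewrite ler_wpM2l ?powR_ge0// lerDl ltW.
Qed.

End mixing_weights.
End conjugate_exponents.

(** * Mixing and domination with the same constant *)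

Section mixing_domination.
Context {R : realType} {A B C G : Type} {K W : ptopologicalType}.
Hypotheses (cptK : compact [set: K]) (hausK : hausdorff_space K).
Hypothesis cptW : compact [set: W].
Variables (H : A -> C -> G -> K -> R) (M : (A -> B) -> A -> C -> G -> W -> R).
Variables (q s : R) (r : \bar R) (T : A -> B).
Hypotheses (q0 : 0 < q) (qs : q <= s) (r0 : (0 < r)%E).
Hypothesis rsq : (r^-1 + (s^-1)%:E = (q^-1)%:E)%E.
Hypothesis contH : forall a c g, continuous (H a c g).
Hypothesis contM : forall a c g, continuous (M T a c g).
Variable delta : R.
Hypothesis delta0 : 0 <= delta.

Let s0 : 0 < s. Proof. exact: lt_le_trans qs. Qed.

Let intM (mu : probability (Borel W) R) a c g : R :=
  \int[mu]_(psi in [set: Borel W]) (`|M T a c g psi| `^ s).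

Let intM_ge0 mu a c g : 0 <= intM mu a c g.
Proof. by apply: Rintegral_ge0 => *; exact: powR_ge0. Qed.

Let contMs a c g : continuous (fun psi => `|M T a c g psi| `^ s).
Proof. exact: continuous_norm_powR. Qed.

Let contHq a c g : continuous (fun phi => `|H a c g phi| `^ q).
Proof. exact: continuous_norm_powR. Qed.

Let intHq_ge0 (nu : probability (Borel K) R) a c g :
  0 <= \int[nu]_(phi in [set: Borel K]) (`|H a c g phi| `^ q).
Proof. by apply: Rintegral_ge0 => *; exact: powR_ge0. Qed.

(** [lnorm_hoelder] separates tau from y_j = |sigma_j/tau_j|^s times the integral of |M_j|^s. The
    sum of the y_j is the integral of a function bounded by the s-th power of the supremum, and [mu]
    has mass 1. *)
Let wsum_intM_le (mu : probability (Borel W) R) m (sigma tau : 'I_m -> R)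
    (a : 'I_m -> A) (c : 'I_m -> C) (g : 'I_m -> G) :
  (forall j, tau j != 0) ->
  (((\sum_j `|sigma j| `^ q * intM mu (a j) (c j) (g j) `^ (q / s)) `^ q^-1)%:E <=
   (lnorm r tau)%:E * sup_wnorm s (fun j => (sigma j / tau j)%R)
     (fun j psi => M T (a j) (c j) (g j) psi))%E.
Proof.
move=> tau0.
have [psi -> wmax] := sup_wnorm_attained cptW (fun j => sigma j / tau j) s0
  (fun j => @contM (a j) (c j) (g j)).
set w := wnorm _ _ _ in wmax *; rewrite -EFinM lee_fin.
have l0 : 0 <= lnorm r tau.
  case: (r) => [p| |]; rewrite /lnorm ?powR_ge0//; exact: bigmax_ge_id.
have w0 : 0 <= w by exact: powR_ge0.
rewrite -[leRHS](powRK q0) ?mulr_ge0// powR_le ?invr_ge0 ?(ltW q0)//.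
  by apply: sumr_ge0 => j _; rewrite mulr_ge0 ?powR_ge0.
rewrite powRM//.
pose y j := `|sigma j / tau j| `^ s * intM mu (a j) (c j) (g j).
have y0 j : 0 <= y j by rewrite mulr_ge0 ?powR_ge0.
have yw : \sum_j y j <= w `^ s.
  apply: (Rintegral_wsum_le cptW mu (w := fun j => `|sigma j / tau j| `^ s)
    (h := fun j psi => `|M T (a j) (c j) (g j) psi| `^ s)) => [j|psi'].
    exact: contMs.
  rewrite -(wnormK _ (fun j => M T (a j) (c j) (g j) psi') s0).
  exact: (powR_le (ltW s0) (powR_ge0 _ _) (wmax psi')).
have -> : w `^ q = (w `^ s) `^ (q / s) by rewrite -powRrM mulrC divfK ?gt_eqF.
apply: (@le_trans _ _ (lnorm r tau `^ q * (\sum_j y j) `^ (q / s))); last first.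
  apply: ler_wpM2l; first exact: powR_ge0.
  apply: powR_le yw; first by rewrite divr_ge0// ltW.
  by apply: sumr_ge0 => j _; exact: y0.
apply: le_trans (lnorm_hoelder q0 qs r0 rsq tau y0).
rewrite le_eqVlt; apply/orP; left; apply/eqP/eq_bigr => j _.
rewrite powRM ?powR_ge0// -powRrM [s * _]mulrC divfK ?gt_eqF// mulrA.
by rewrite -powRM// -normrM [tau j * _]mulrC divfK.
Qed.

Lemma mixing_const_domination :
  mixing_const H M s q r T delta -> domination_const H M s q T delta.
Proof.
move=> mixT mu.
pose N (i : A * C * G) := intM mu i.1.1 i.1.2 i.2 `^ (q / s).
pose h (i : A * C * G) phi := delta `^ q * `|H i.1.1 i.1.2 i.2 phi| `^ q.
have [| |m i w m0 w0|nu nuP] := @pietsch_domination R K cptK hausK _ N h.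
- by move=> i x; apply: cvgMr; exact: contHq.
- by move=> i x; rewrite mulr_ge0 ?powR_ge0.
(* Arbitrary positive weights are realised as |sigma_j|^q, which brings the mixing inequality into
   the form required for [pietsch_domination]. *)
- pose sigma j := w j `^ q^-1.
  have sw j : `|sigma j| `^ q = w j.
    by rewrite ger0_norm ?powR_ge0// powRVK// ltW.
  have sigma0 j : sigma j != 0 by rewrite gt_eqF// powR_gt0.
  have := mixT m sigma (fun j => (i j).1.1) (fun j => (i j).1.2)
    (fun j => (i j).2) m0 sigma0.
  have [phi -> _] := sup_wnorm_attained cptK sigma q0
    (fun j => @contH (i j).1.1 (i j).1.2 (i j).2).
  set wH := wnorm _ _ _.
  have wH0 : 0 <= wH by exact: powR_ge0.
  set S := \sum_j w j * N (i j).
  have S0 : 0 <= S.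
    by apply: sumr_ge0 => j _; rewrite mulr_ge0 ?powR_ge0// ltW.
  have : ((S `^ q^-1)%:E <= mixing_quantity M s r sigma T (fun j => (i j).1.1)
      (fun j => (i j).1.2) (fun j => (i j).2))%E.
    apply: le_ereal_inf_tmp => _ [tau tau0 <-].
    have := @wsum_intM_le mu m sigma tau (fun j => (i j).1.1)
      (fun j => (i j).1.2) (fun j => (i j).2) tau0.
    by under eq_bigr do rewrite sw.
  move=> /le_trans/[apply]; rewrite -EFinM lee_fin => SdH.
  exists phi; have := powR_le (ltW q0) (powR_ge0 _ _) SdH.
  rewrite powRVK// powRM// wnormK// mulr_sumr => /le_trans; apply.
  apply: ler_sum => j _.
  by rewrite sw /h mulrCA.
exists nu => a c g; rewrite !int_normE// -EFinM lee_fin -/(intM mu a c g).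
have := nuP (a, c, g); rewrite /N /h/= RintegralZl//; last exact: continuous_integrable.
move=> /(powR_le (ltW (_ : 0 < q^-1)) (powR_ge0 _ _)); rewrite invr_gt0 => /(_ q0).
rewrite -powRrM mulrAC divff ?gt_eqF// mul1r => /le_trans; apply.
by rewrite powRM ?powR_ge0// powRK.
Qed.

Lemma domination_const_mixing :
  domination_const H M s q T delta -> mixing_const H M s q r T delta.
Proof.
move=> domT m sigma a c g m0 sigma0.
have [phi -> wmax] := sup_wnorm_attained cptK sigma q0
  (fun j => @contH (a j) (c j) (g j)).
set wH := wnorm _ _ _ in wmax *; have wH0 : 0 <= wH by exact: powR_ge0.
rewrite -EFinM.
pose x j psi := `|sigma j| `^ s * `|M T (a j) (c j) (g j) psi| `^ s.
have cx j : continuous (x j) by move=> psi; apply: cvgMr; exact: contMs.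
have x0 j psi : 0 <= x j psi by rewrite mulr_ge0 ?powR_ge0.
(* The domination inequalities are raised to the power q, weighted by |sigma_j|^q and summed; the
   resulting integral against the probability [nu] is at most the maximum over [K]. *)
have claim (mu : probability (Borel W) R) :
    \sum_j (\int[mu]_(psi in [set: Borel W]) x j psi) `^ (q / s) <= (delta * wH) `^ q.
  have [nu nuP] := domT mu.
  rewrite powRM//; apply: (@le_trans _ _ (delta `^ q *
    \sum_j `|sigma j| `^ q *
      \int[nu]_(phi in [set: Borel K]) (`|H (a j) (c j) (g j) phi| `^ q))).
    rewrite mulr_sumr; apply: ler_sum => j _.
    rewrite RintegralZl//; last exact: continuous_integrable.
    rewrite (powRM _ (powR_ge0 _ _) (intM_ge0 mu (a j) (c j) (g j))).
    rewrite -powRrM [s * _]mulrC divfK ?gt_eqF// mulrCA ler_wpM2l ?powR_ge0//.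
    have := nuP (a j) (c j) (g j); rewrite !int_normE// -EFinM lee_fin.
    move=> /(powR_le (ltW q0) (powR_ge0 _ _)); rewrite powRM ?powR_ge0//.
    by rewrite -powRrM mulrC powRVK// [s^-1 * q]mulrC.
  rewrite ler_wpM2l ?powR_ge0//.
  apply: (Rintegral_wsum_le cptK nu (w := fun j => `|sigma j| `^ q)
    (h := fun j phi => `|H (a j) (c j) (g j) phi| `^ q)) => [j|phi'].
    exact: contHq.
  rewrite -(wnormK _ (fun j => H (a j) (c j) (g j) phi') q0).
  exact: (powR_le (ltW q0) (powR_ge0 _ _) (wmax phi')).
(* The slack [e] provides the strict inequality [z0 < z] that [mixing_weights] requires. *)
apply/lee_addgt0Pr => e e0; rewrite -EFinD.
have [|tau [tau0 l0 tauP]] := mixing_weights q0 qs r0 rsq cptW cx x0 _ claim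
  (z := delta * wH + e).
  by rewrite mulr_ge0// ltrDl.
apply: (@le_trans _ _ ((lnorm r tau)%:E *
      sup_wnorm s (fun j => (sigma j / tau j)%R)
        (fun j psi => M T (a j) (c j) (g j) psi))%E).
  by apply: ereal_inf_lbound; exists tau => // j; rewrite gt_eqF.
have [psi -> _] := sup_wnorm_attained cptW (fun j => sigma j / tau j) s0
  (fun j => @contM (a j) (c j) (g j)).
rewrite -EFinM lee_fin; apply: le_trans (tauP psi).
rewrite ler_wpM2l// /wnorm le_eqVlt; apply/orP; left; apply/eqP.
congr (_ `^ _); apply: eq_bigr => j _.
rewrite normrM powRM// -mulrA mulrCA; congr (_ * _).
rewrite normrV ?unitfE ?gt_eqF// gtr0_norm//.
by rewrite -powR_inv1 ?(ltW (tau0 j))// -powRrM mulN1r.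
Qed.

End mixing_domination.

Local Open Scope ereal_scope.

Theorem proposition13 (R : realType) (A B C C1 D : Type)
  (A0 : inhabited A) (B0 : inhabited B) (C0 : inhabited C)
  (C10 : inhabited C1) (D0 : inhabited D)
  (G : completeNormedModType R)
  (K W : ptopologicalType)
  (cptK : compact [set: K]) (hausK : hausdorff_space K)
  (cptW : compact [set: W]) (hausW : hausdorff_space W)
  (famH : set (A -> B)) (famH1 : set (B -> D)) (famH2 : set (A -> D))
  (famH_neq0 : famH !=set0) (famH1_neq0 : famH1 !=set0)
  (famH2_neq0 : famH2 !=set0)
  (fam_comp : forall T S, famH T -> famH1 S -> famH2 (S \o T))
  (H : A -> C -> G -> K -> R) (H1 : B -> C1 -> G -> W -> R)
  (Q1 : (B -> D) -> B -> C1 -> G -> R) (Q2 : (A -> D) -> A -> C -> G -> R)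
  (M : (A -> B) -> A -> C -> G -> W -> R)
  (q s : R) (r : \bar R)
  (q_gt0 : (0 < q)%R) (le_qs : (q <= s)%R) (s_ge1 : (1 <= s)%R)
  (r_gt0 : 0 < r) (rsq : r^-1 + (s^-1)%:E = (q^-1)%:E)
  (contH : forall a c g, continuous (H a c g))
  (contM : forall T a c g, famH T -> continuous (M T a c g))
  (exJ : forall mu : probability (Borel W) R,
     exists J : B -> D,
       [/\ famH1 J,
           abstract_summing H1 Q1 s J,
           summing_norm H1 Q1 s J <= 1 &
           forall T a c g, famH T ->
             int_norm mu s (M T a c g) <= `|Q2 (J \o T) a c g|%:E])
  (T : A -> B) (famT : famH T) :
  (mixing H M s q r T <->
     exists delta : R, (0 <= delta)%R /\ domination_const H M s q T delta) /\
  mixing_norm H M s q r T =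
    ereal_inf [set delta%:E | delta in
      [set delta : R | (0 <= delta)%R /\ domination_const H M s q T delta]].
Proof.
have key delta : (0 <= delta)%R ->
    mixing_const H M s q r T delta <-> domination_const H M s q T delta.
  move=> delta0; split.
    by apply: mixing_const_domination => // a c g; exact: contM.
  by apply: domination_const_mixing => // a c g; exact: contM.
(* Equal sets of admissible constants give both the equivalence and the equality of the infima. *)
have E : [set delta : R | (0 <= delta)%R /\ mixing_const H M s q r T delta] =
         [set delta : R | (0 <= delta)%R /\ domination_const H M s q T delta].
  by apply/seteqP; split => delta [d0 /(key _ d0)].
split; last by rewrite /mixing_norm E.
by split => -[delta [d0 /(key _ d0)]]; exists delta.
Qed.
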